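(* $[\mathcal{F}]$ is a monotone class in $\mathcal{P}(\mathbb{N}) / \mathcal{N}$, on which $\nu$ is countably additive.
   Context: $\mathbb{N} = \{1,2,3,\ldots\}$ and $\mathcal{P}(\mathbb{N})$ is its power set. For $A \subseteq \mathbb{N}$ and $N \in \mathbb{N}$, $\nu_N(A) := \frac{1}{N}\sum_{n=1}^N I_A(n)$, where $I_A$ is the indicator function of $A$. $\mathcal{F}$ is the collection of all $A \subseteq \mathbb{N}$ for which $\lim_{N\to\infty}\nu_N(A)$ exists, and for $A\in\mathcal{F}$, $\nu(A)$ denotes this limit. $\mathcal{N} := \{A\in\mathcal{F} : \nu(A)=0\}$, which is an ideal of the Boolean algebra $\mathcal{P}(\mathbb{N})$. $\mathcal{P}(\mathbb{N})/\mathcal{N}$ is the quotient Boolean algebra, whose elements are the equivalence classes $[A]$ of sets $A\subseteq\mathbb{N}$ under $A\sim B \iff A\triangle B\in\mathcal{N}$, with operations induced by those on sets. $[\mathcal{F}] := \{[A] : A\in\mathcal{F}\}$, and $\nu$ induces a well-defined function on $[\mathcal{F}]$ by $\nu[A] := \nu(A)$ for $A \in \mathcal{F}$. A subset $\mathcal{M}$ of a Boolean algebra $\mathcal{A}$ is a monotone class in $\mathcal{A}$ if every non-decreasing sequence $p_1\leq p_2\leq\ldots$ in $\mathcal{M}$ has an upper bound in $\mathcal{M}$ that is less than any other upper bound of the sequence in $\mathcal{A}$, and every non-increasing sequence $p_1\geq p_2\geq\ldots$ in $\mathcal{M}$ has a lower bound in $\mathcal{M}$ that is greater than any other lower bound of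 the sequence in $\mathcal{A}$. Elements $[A],[B]$ are disjoint if $[A]\wedge[B]=[\emptyset]$, i.e. $A\cap B\in\mathcal{N}$. Countable additivity of $\nu$ on $[\mathcal{F}]$ means: for every sequence $\{a_k\}_{k=1}^\infty$ of pairwise disjoint elements of $[\mathcal{F}]$, the least upper bound $\bigvee_{k=1}^\infty a_k$ in $\mathcal{P}(\mathbb{N})/\mathcal{N}$ exists and lies in $[\mathcal{F}]$, and $\nu(\bigvee_{k=1}^\infty a_k)=\sum_{k=1}^\infty\nu(a_k)$. *)

(* Defs.v *)
From HB Require Import structures.
From mathcomp Require Import all_boot all_order all_algebra.
From mathcomp Require Import all_classical all_reals all_analysis.

Set Implicit Arguments.
Unset Strict Implicit.
Unset Printing Implicit Defensive.

Import Order.TTheory GRing.Theory Num.Theory.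
Import numFieldNormedType.Exports.
Local Open Scope classical_set_scope.
Local Open Scope ring_scope.

(* Natural density on the sets of positive integers, the quotient of the      *)
(* power set by the ideal of density-zero sets as a Boolean algebra (a        *)
(* ctbDistrLatticeType), and monotone classes in a Boolean algebra.           *)

Definition posint := {n : nat | (0 < n)%N}.

Definition posint_succ (n : nat) : posint := exist _ n.+1 (ltn0Sn n).

Section density.
Context {R : realType}.
Implicit Types (A B C : set posint) (l : R).

(* The summation index is shifted: posint_succ k runs through 1, ..., N.  The *)
(* value at N = 0 is irrelevant, as only the limit in N is used.              *)
Definition nu_ (N : nat) A : R :=
  N%:R^-1 * \sum_(0 <= k < N) \1_A (posint_succ k).

Definition has_density : set (set posint) := [set A | cvgn (nu_ ^~ A)].

Definition nu A : R := limn (nu_ ^~ A).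

Definition null : set (set posint) := [set A | has_density A /\ nu A = 0].

Lemma has_density_cvg A l : nu_ ^~ A @ \oo --> l -> has_density A /\ nu A = l.
Proof. by move=> Al; split; [exact: cvgP Al|exact: cvg_lim Al]. Qed.

Lemma nullP A : null A <-> nu_ ^~ A @ \oo --> (0 : R).
Proof. by split=> [[cA <-]//|]; exact: has_density_cvg. Qed.

Lemma nu_ge0 N A : 0 <= nu_ N A.
Proof. by rewrite mulr_ge0// sumr_ge0// => i _; rewrite indicE. Qed.

Lemma le_nu N A B : A `<=` B -> nu_ N A <= nu_ N B.
Proof.
move=> AB; rewrite ler_wpM2l// ler_sum// => i _; rewrite !indicE ler_nat.
have [|//] := boolP (_ \in A); rewrite inE => /AB ?.
by rewrite (_ : _ \in B)// inE.
Qed.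

Lemma nuU_le N A B : nu_ N (A `|` B) <= nu_ N A + nu_ N B.
Proof.
rewrite -mulrDr -big_split/= ler_wpM2l// ler_sum// => i _.
rewrite !indicE in_setU -natrD ler_nat.
by case: (_ \in A); case: (_ \in B).
Qed.

Lemma null_sub A B : A `<=` B -> null B -> null A.
Proof.
move=> AB /nullP B0; apply/nullP; apply: (squeeze_cvgr _ (cvg_cst 0) B0).
by near=> N; rewrite nu_ge0 le_nu.
Unshelve. all: by end_near. Qed.

Lemma null_setU A B : null A -> null B -> null (A `|` B).
Proof.
move=> /nullP A0 /nullP B0; apply/nullP.
have AB0 : nu_ ^~ A \+ nu_ ^~ B @ \oo --> (0 : R).
  by rewrite -[X in _ --> X]addr0; exact: cvgD.
apply: (squeeze_cvgr _ (cvg_cst 0) AB0).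
by near=> N; rewrite nu_ge0 nuU_le.
Unshelve. all: by end_near. Qed.

Lemma null_set0 : null set0.
Proof.
apply/nullP; rewrite (_ : nu_ ^~ set0 = fun=> 0); first exact: cvg_cst.
by apply/funext => N; rewrite /nu_ big1 ?mulr0// => i _; rewrite indic0.
Qed.

Definition sim A B : bool := `[< null (A `+` B) >].

Lemma sim_refl : reflexive sim.
Proof. by move=> A; apply/asboolP; rewrite setYK; exact: null_set0. Qed.

Lemma sim_sym : symmetric sim.
Proof. by move=> A B; rewrite /sim setYC. Qed.

Lemma sim_trans : transitive sim.
Proof.
move=> B A C /asboolP AB /asboolP BC; apply/asboolP.
apply: null_sub (null_setU AB BC) => x.
have [Bx|nBx] := pselect (B x); rewrite /setY/setU/setD/mkset/=; tauto.
Qed.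

Lemma sim_cvg A B l :
  sim A B -> nu_ ^~ A @ \oo --> l -> nu_ ^~ B @ \oo --> l.
Proof.
move=> /asboolP/nullP AB Al; have lB : nu_ ^~ A \- nu_ ^~ (A `+` B) @ \oo --> l.
  by rewrite -[X in _ --> X]subr0; exact: cvgB.
have uB : nu_ ^~ A \+ nu_ ^~ (A `+` B) @ \oo --> l.
  by rewrite -[X in _ --> X]addr0; exact: cvgD.
apply: (squeeze_cvgr _ lB uB); near=> N => /=.
rewrite lerBlDr; apply/andP; split.
  apply: le_trans (nuU_le _ _ _); apply: le_nu => x Ax.
  have [Bx|nBx] := pselect (B x); rewrite /setY/setU/setD/mkset/=; tauto.
apply: le_trans (nuU_le _ _ _); apply: le_nu => x Bx.
have [Ax|nAx] := pselect (A x); rewrite /setY/setU/setD/mkset/=; tauto.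
Unshelve. all: by end_near. Qed.

Lemma sim_has_density A B : sim A B -> has_density A -> has_density B.
Proof. by move=> AB dA; have [] := has_density_cvg (sim_cvg AB dA). Qed.

Lemma sim_nu A B : sim A B -> has_density A -> nu B = nu A.
Proof. by move=> AB dA; have [] := has_density_cvg (sim_cvg AB dA). Qed.

Lemma simI A B C D : sim A B -> sim C D -> sim (A `&` C) (B `&` D).
Proof.
move=> /asboolP AB /asboolP CD; apply/asboolP.
apply: null_sub (null_setU AB CD) => x.
have [Ax|nAx] := pselect (A x); have [Bx|nBx] := pselect (B x);
  rewrite /setY/setU/setD/setI/mkset/=; tauto.
Qed.

Lemma simC A B : sim A B -> sim (~` A) (~` B).
Proof.
move=> /asboolP AB; apply/asboolP; apply: null_sub AB => x.
have [Ax|nAx] := pselect (A x); have [Bx|nBx] := pselect (B x);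
  rewrite /setY/setU/setD/setC/mkset/=; tauto.
Qed.

Lemma simU A B C D : sim A B -> sim C D -> sim (A `|` C) (B `|` D).
Proof.
move=> AB CD; rewrite -[A `|` C]setCK -[B `|` D]setCK !setCU.
by apply: simC; apply: simI; exact: simC.
Qed.

End density.

Canonical sim_equiv (R : realType) :=
  EquivRel (@sim R) sim_refl sim_sym sim_trans.

Definition quot_null (R : realType) := {eq_quot (@sim R)}%qT.

HB.instance Definition _ (R : realType) := Choice.on (quot_null R).
HB.instance Definition _ (R : realType) := EqQuotient.on (quot_null R).

Section boolean_algebra.
Context {R : realType}.
Implicit Types (A B : set posint) (x y z : quot_null R).

Definition cls A : quot_null R := \pi_(quot_null R)%qT A.

Lemma clsP A B : cls A = cls B <-> null (R := R) (A `+` B).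
Proof.
split=> [/eqmodP AB|AB]; first exact/asboolP.
by apply/eqmodP; exact/asboolP.
Qed.

Lemma cls_ind (P : quot_null R -> Prop) : (forall A, P (cls A)) -> forall x, P x.
Proof. by move=> PA x; rewrite -(reprK x); exact: PA. Qed.

Lemma sim_repr A : sim (R := R) (repr (cls A)) A.
Proof. by apply/eqmodP; rewrite reprK. Qed.

Definition qmeet x y := cls (repr x `&` repr y).
Definition qjoin x y := cls (repr x `|` repr y).
Definition qcompl x := cls (~` repr x).
Definition qle x y := qmeet x y == x.
Definition qlt x y := (y != x) && qle x y.

Lemma qmeet_cls A B : qmeet (cls A) (cls B) = cls (A `&` B).
Proof. by apply/eqmodP; apply: simI; exact: sim_repr. Qed.

Lemma qjoin_cls A B : qjoin (cls A) (cls B) = cls (A `|` B).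
Proof. by apply/eqmodP; apply: simU; exact: sim_repr. Qed.

Lemma qcompl_cls A : qcompl (cls A) = cls (~` A).
Proof. by apply/eqmodP; apply: simC; exact: sim_repr. Qed.

Let qmeetC : commutative qmeet.
Proof. by elim/cls_ind=> A; elim/cls_ind=> B; rewrite !qmeet_cls setIC. Qed.

Let qjoinC : commutative qjoin.
Proof. by elim/cls_ind=> A; elim/cls_ind=> B; rewrite !qjoin_cls setUC. Qed.

Let qmeetA : associative qmeet.
Proof.
by elim/cls_ind=> A; elim/cls_ind=> B; elim/cls_ind=> C; rewrite !qmeet_cls setIA.
Qed.

Let qjoinA : associative qjoin.
Proof.
by elim/cls_ind=> A; elim/cls_ind=> B; elim/cls_ind=> C; rewrite !qjoin_cls setUA.
Qed.

Let qjoinKI y x : qmeet x (qjoin x y) = x.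
Proof.
by elim/cls_ind: x => A; elim/cls_ind: y => B; rewrite qjoin_cls qmeet_cls setUC setKU.
Qed.

Let qmeetKU y x : qjoin x (qmeet x y) = x.
Proof.
by elim/cls_ind: x => A; elim/cls_ind: y => B; rewrite qmeet_cls qjoin_cls setIC setKI.
Qed.

Let qmeetUl : left_distributive qmeet qjoin.
Proof.
elim/cls_ind=> A; elim/cls_ind=> B; elim/cls_ind=> C.
by rewrite qjoin_cls !qmeet_cls qjoin_cls setIUl.
Qed.

Let qmeetxx : idempotent_op qmeet.
Proof. by elim/cls_ind=> A; rewrite qmeet_cls setIid. Qed.

Fact quot_null_display : Order.disp_t. Proof. exact. Qed.

HB.instance Definition _ :=
  Order.isMeetJoinDistrLattice.Build quot_null_display (quot_null R)
    (fun _ _ => erefl) (fun _ _ => erefl)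
    qmeetC qjoinC qmeetA qjoinA qjoinKI qmeetKU qmeetUl qmeetxx.

Let qle0x x : (cls set0 <= x)%O.
Proof. by elim/cls_ind: x => A; apply/eqP; rewrite qmeet_cls set0I. Qed.

Let qlex1 x : (x <= cls setT)%O.
Proof. by elim/cls_ind: x => A; apply/eqP; rewrite qmeet_cls setIT. Qed.

HB.instance Definition _ :=
  Order.hasBottom.Build quot_null_display (quot_null R) qle0x.
HB.instance Definition _ :=
  Order.hasTop.Build quot_null_display (quot_null R) qlex1.

Let qjoinxC x : (x `|` qcompl x)%O = \top%O.
Proof. by elim/cls_ind: x => A; rewrite qcompl_cls [LHS]qjoin_cls setUv. Qed.

Let qmeetxC x : (x `&` qcompl x)%O = \bot%O.
Proof. by elim/cls_ind: x => A; rewrite qcompl_cls [LHS]qmeet_cls setICr. Qed.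

HB.instance Definition _ :=
  Order.TBDistrLattice_hasComplement.Build quot_null_display (quot_null R)
    qjoinxC qmeetxC.

Lemma meet_cls A B : (cls A `&` cls B)%O = cls (A `&` B).
Proof. exact: qmeet_cls. Qed.

Lemma join_cls A B : (cls A `|` cls B)%O = cls (A `|` B).
Proof. exact: qjoin_cls. Qed.

Lemma compl_cls A : (~` cls A)%O = cls (~` A).
Proof. exact: qcompl_cls. Qed.

Lemma bot_cls : \bot%O = cls set0. Proof. by []. Qed.

Lemma top_cls : \top%O = cls setT. Proof. by []. Qed.

Lemma le_cls A B : (cls A <= cls B)%O <-> null (R := R) (A `\` B).
Proof.
rewrite leEmeet meet_cls; split => [/eqP/clsP|AB].
  by apply: null_sub => x [Ax nBx]; right; split=> // -[].
apply/eqP/clsP; apply: null_sub AB => x.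
by move=> [[[Ax _] /(_ Ax)]//|[Ax /not_andP[//|nBx]]].
Qed.

Definition cls_density : set (quot_null R) := cls @` has_density (R := R).

(* Only meaningful on cls_density, where it is computed by nu_clsE. *)
Definition nu_cls x : R := nu (repr x).

Lemma nu_clsE A : has_density (R := R) A -> nu_cls (cls A) = nu A.
Proof. by apply: sim_nu; rewrite sim_sym; exact: sim_repr. Qed.

End boolean_algebra.

Section monotone_additive.
Context d (T : ctbDistrLatticeType d).
Implicit Types (M : set T) (p : nat -> T).

(* supremums S (resp. infimums S) is the set of least upper (resp. greatest   *)
(* lower) bounds of S in the whole of T.  Sequences are indexed from 0.       *)
Definition is_monotone_class M : Prop :=
  (forall p, (forall k, M (p k)) -> nondecreasing_seq p ->
     exists2 s, M s & supremums (range p) s) /\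
  (forall p, (forall k, M (p k)) -> nonincreasing_seq p ->
     exists2 s, M s & infimums (range p) s).

Definition is_countably_additive (R : realType) M (m : T -> R) : Prop :=
  forall a : nat -> T, (forall k, M (a k)) ->
    (forall j k, j != k -> (a j `&` a k)%O = \bot%O) ->
    exists s, [/\ supremums (range a) s, M s & series (m \o a) @ \oo --> m s].

End monotone_additive.

(* Main.v *)
Require Import Defs.
From mathcomp Require Import all_boot all_order all_algebra.
From mathcomp Require Import all_classical all_reals all_analysis.
From mathcomp Require Import lra zify.

(** Write F for the sets that have a density.  Everything reduces to
    increasing sequences of classes: complementation maps F to itself and
    reverses the order, which turns an infimum into a supremum, and the join of
    a disjoint sequence is the supremum of its finite partial joins, whose
    densities are the partial sums of the series.

    An increasing sequence of classes is represented by sets U_0, U_1, ... that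
    are genuinely nested (cls_nested_lift).  Their union need not have a
    density, and when it has one the value can be too large: the sets
    {1, ..., k} are null, yet their union has density 1.  A null set may however
    be discarded from each U_k, and initial segments are null; so let A be the
    union of the sets U_k \ [1, M_k], with M_k so large that the frequencies of
    U_k beyond M_k no longer exceed its density noticeably.  Up to N, the set A
    is contained in the last U_k with M_k < N, which bounds its frequencies from
    above by about L, the limit of the densities of the U_k; it contains each
    U_k up to a null set, which bounds them from below.  Thus A has density L
    (nested_union_density).

    Having the right density also makes A a least upper bound
    (null_setD_of_density).  If B contains every U_k up to a null set, then so
    does the part of A inside B, and hence the frequencies of A \ B are at most
    about L minus the density of U_k, for each k; this difference tends to 0. *)

Set Implicit Arguments.
Unset Strict Implicit.
Unset Printing Implicit Defensive.

Import Order.Theory GRing.Theory Num.Theory.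
Import numFieldNormedType.Exports.
Local Open Scope classical_set_scope.
Local Open Scope ring_scope.

(** * Frequencies on initial segments *)

Section Frequencies.
Context {R : realType}.
Implicit Types (A B : set posint).
Local Notation nu_ := (@nu_ R).

(** Inclusion-exclusion in a form free of subtraction. *)
Lemma nu_modular N A B : nu_ N A + nu_ N B = nu_ N (A `|` B) + nu_ N (A `&` B).
Proof.
rewrite -!mulrDr -!big_split/=; congr (_ * _); apply: eq_bigr => i _.
rewrite !indicE in_setU in_setI -!natrD.
by case: (_ \in A); case: (_ \in B).
Qed.

Lemma nu_set0 N : nu_ N set0 = 0.
Proof. by rewrite /nu_ big1 ?mulr0// => i _; rewrite indic0. Qed.

Lemma nu_setT N : nu_ N.+1 setT = 1.
Proof.
rewrite /nu_ (eq_bigr (fun=> 1)) => [|i _]; last by rewrite indicT.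
by rewrite sumr_const_nat subn0 mulVf// pnatr_eq0.
Qed.

Lemma nu_setC N A : nu_ N.+1 (~` A) = 1 - nu_ N.+1 A.
Proof.
have := nu_modular N.+1 A (~` A).
by rewrite setUv setICr nu_setT nu_set0 addr0 => <-; rewrite addrC addKr.
Qed.

Lemma nu_le1 N A : nu_ N A <= 1.
Proof.
case: N => [|N]; first by rewrite /nu_ invr0 mul0r.
by rewrite -(nu_setT N) le_nu.
Qed.

Lemma null_initial_segment (M : nat) :
  null (R := R) [set n : posint | (sval n <= M)%N].
Proof.
set F := [set n : posint | _].
have sumF N : \sum_(0 <= k < N) (\1_F (posint_succ k) : R) <= M%:R.
  rewrite (_ : \sum_(0 <= k < N) _ = (minn N M)%:R) ?ler_nat ?geq_minr//.
  elim: N => [|N IH]; first by rewrite big_nil min0n.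
  rewrite big_nat_recr//= IH indicE.
  have -> : (posint_succ N \in F) = (N < M)%N.
    by apply/idP/idP; rewrite inE.
  rewrite -natrD; congr _%:R; rewrite /minn.
  by case: (ltngtP N M) => [NM|MN|->]; rewrite ?ltnn ?addn0//; case: ltngtP; lia.
apply/nullP.
have MN0 : (fun N : nat => N%:R^-1 * M%:R : R) @ \oo --> (0 : R).
  rewrite -(mul0r (M%:R : R)); apply: cvgMl.
  apply/gtr0_cvgV0; last exact: cvgr_idn.
  by near=> N; rewrite ltr0n; near: N; exact: nbhs_infty_gt.
apply: (squeeze_cvgr _ (cvg_cst 0) MN0); near=> N.
by rewrite nu_ge0 ler_wpM2l.
Unshelve. all: by end_near. Qed.

End Frequencies.

(** * Sets with a density *)

Section Densities.
Context {R : realType}.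
Implicit Types (A B : set posint) (U : nat -> set posint) (a b : R).
Local Notation nu_ := (@nu_ R).

Lemma density_setC A a : nu_ ^~ A @ \oo --> a -> nu_ ^~ (~` A) @ \oo --> 1 - a.
Proof.
move=> Aa; rewrite -cvg_shiftS.
under eq_fun do rewrite nu_setC.
apply: cvgB; first exact: cvg_cst.
by rewrite (cvg_shiftS (nu_ ^~ A)).
Qed.

Lemma density_setU A B a b : null (R := R) (A `&` B) ->
  nu_ ^~ A @ \oo --> a -> nu_ ^~ B @ \oo --> b ->
  nu_ ^~ (A `|` B) @ \oo --> a + b.
Proof.
move=> /nullP AB Aa Bb.
have -> : nu_ ^~ (A `|` B) = (nu_ ^~ A \+ nu_ ^~ B) \- nu_ ^~ (A `&` B).
  by apply/funext => N /=; rewrite nu_modular addrK.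
by rewrite -(subr0 (a + b)); apply: cvgB => //; exact: cvgD.
Qed.

(** The thresholds M are chosen with k <= M k: each N then exceeds finitely
    many M k, so there is a largest such k, and that U k contains
    everything that the union of the truncated sets has up to N. *)
Lemma nested_union_density U (d : nat -> R) (L : R) :
  {homo U : j k / (j <= k)%N >-> j `<=` k} ->
  (forall k, nu_ ^~ (U k) @ \oo --> d k) ->
  (forall k, d k <= L) -> d @ \oo --> L ->
  exists2 A, nu_ ^~ A @ \oo --> L & forall k, null (R := R) (U k `\` A).
Proof.
move=> incU Ud dL dcvg.
have threshold k : exists M, (k <= M)%N /\
    forall N, (M <= N)%N -> nu_ N (U k) < L + k.+1%:R^-1.
  have Lk : d k < L + k.+1%:R^-1 by rewrite ltr_pwDr// invr_gt0 ltr0n.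
  have [M _ MP] := cvgr_lt _ (Ud k) _ Lk.
  exists (maxn k M); split; first exact: leq_maxl.
  by move=> N MN; apply: MP => /=; exact: leq_trans (leq_maxr _ _) MN.
have [M MP] := choice threshold.
pose A := [set n : posint | exists2 k, U k n & (M k < sval n)%N].
have UA k : null (R := R) (U k `\` A).
  apply: null_sub (null_initial_segment (M k)) => n [Un nAn] /=.
  by rewrite leqNgt; apply/negP => Mn; apply: nAn; exists k.
exists A => //.
have upper m N : (M m < N)%N -> nu_ N A <= L + m.+1%:R^-1.
  (* U k for the largest k with M k < N; note that k >= m. *)
  move=> mN; pose P j := (M j < N)%N.
  have exP : exists j, P j by exists m.
  have ubP j : P j -> (j <= N)%N.
    by move=> Pj; apply: ltnW; apply: leq_ltn_trans Pj; exact: (MP j).1.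
  have [k Pk kmax] := ex_maxnP exP ubP.
  have ANU : nu_ N A <= nu_ N (U k).
    rewrite ler_wpM2l// !big_mkord ler_sum// => i _; rewrite !indicE ler_nat.
    have [|//] := boolP (_ \in A); rewrite inE => -[j Uj /= Mj].
    rewrite (_ : _ \in U k)// inE; apply: incU Uj; apply: kmax.
    exact: leq_trans Mj (ltn_ord i).
  have mk := kmax _ mN.
  apply: (le_trans ANU); apply: (le_trans (ltW ((MP k).2 _ (ltnW Pk)))).
  by rewrite lerD2l lef_pV2 ?posrE ?ltr0n// ler_nat.
(* U j controls A from below, the bound [upper m] from above. *)
apply/cvgrPdist_le => e e0.
have [m me] : exists m, (m.+1%:R^-1 : R) < e.
  have [m _ mP] := cvgr_lt _ (@cvg_harmonic R) _ e0.
  by exists m; apply: (mP m) => /=.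
have [j Lj] : exists j, L - e < d j.
  have Le : L - e < L by rewrite ltrBlDr ltrDl.
  have [j _ jP] := cvgr_gt _ dcvg _ Le.
  by exists j; apply: (jP j) => /=.
have low : nu_ ^~ (U j) \- nu_ ^~ (U j `\` A) @ \oo --> d j.
  by rewrite -(subr0 (d j)); apply: cvgB (Ud j) _; exact/nullP.
near=> N.
have AN : nu_ N A <= L + m.+1%:R^-1.
  by apply: upper; near: N; exact: nbhs_infty_gt.
have lowN : L - e < nu_ N (U j) - nu_ N (U j `\` A).
  by near: N; exact: cvgr_gt low _ Lj.
have UN : nu_ N (U j) <= nu_ N A + nu_ N (U j `\` A).
  apply: le_trans (nuU_le _ _ _); apply: le_nu => n Un.
  by have [An|nAn] := pselect (A n); [left|right].
rewrite ler_distlC; apply/andP; split.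
  by apply: ltW (lt_le_trans lowN _); rewrite lerBlDr.
by apply: (le_trans AN); rewrite lerD2l ltW.
Unshelve. all: by end_near. Qed.

(** An almost-upper bound A of the U k whose density is the limit of theirs lies
    almost inside every other almost-upper bound B: what A has outside B is, up
    to null sets, outside U k, where A has density L - d k. *)
Lemma null_setD_of_density U (d : nat -> R) (L : R) A B :
  (forall k, nu_ ^~ (U k) @ \oo --> d k) -> d @ \oo --> L ->
  nu_ ^~ A @ \oo --> L -> (forall k, null (R := R) (U k `\` A)) ->
  (forall k, null (R := R) (U k `\` B)) -> null (R := R) (A `\` B).
Proof.
move=> Ud dL AL UA UB; apply/nullP/cvgrPdist_le => e e0.
have Le : L - e < L by rewrite ltrBlDr ltrDl.
have [k Lk] : exists k, L - e < d k.
  have [k _ kP] := cvgr_gt _ dL _ Le.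
  by exists k; apply: (kP k) => /=.
(* Equivalently, A \ B and U k together have, counted with multiplicity, at
   most as many elements as A, U k \ A and U k \ B. *)
have bound N : nu_ N (A `\` B) <=
    nu_ N A - nu_ N (U k) + nu_ N (U k `\` A) + nu_ N (U k `\` B).
  have := nu_modular (R := R) N (A `\` B) (U k).
  have : nu_ N ((A `\` B) `|` U k) <= nu_ N A + nu_ N (U k `\` A).
    apply: le_trans (nuU_le _ _ _); apply: le_nu => n.
    by have [An|nAn] := pselect (A n); [left|case=> [[]|] //; right].
  have : nu_ N ((A `\` B) `&` U k) <= nu_ N (U k `\` B).
    by apply: le_nu => n [[_ nBn] Un].
  lra.
have cvg_bound : nu_ ^~ A \- nu_ ^~ (U k) \+ nu_ ^~ (U k `\` A)
    \+ nu_ ^~ (U k `\` B) @ \oo --> L - d k.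
  have -> : L - d k = L - d k + 0 + 0 by rewrite !addr0.
  apply: cvgD; last exact/nullP.
  apply: cvgD; last exact/nullP.
  exact: cvgB.
have Lke : L - d k < e by rewrite ltrBlDr addrC -ltrBlDr.
near=> N.
rewrite sub0r normrN ger0_norm ?nu_ge0//.
apply: (le_trans (bound N)); apply: ltW.
by near: N; exact: cvgr_lt cvg_bound _ Lke.
Unshelve. all: by end_near. Qed.

End Densities.

(** * Classes modulo null sets *)

Section Quotient.
Context {R : realType}.
Implicit Types (x y : quot_null R) (p : nat -> quot_null R).

Lemma cls_densityP x :
  cls_density x <-> nu_ ^~ (repr x) @ \oo --> nu_cls x.
Proof.
split=> [[A dA <-]|xd].
  rewrite nu_clsE//; apply: sim_cvg dA; rewrite sim_sym; exact: sim_repr.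
by exists (repr x); [exact: cvgP xd|exact: reprK].
Qed.

Lemma cls_cvg A x : cls A = x -> cls_density x ->
  nu_ ^~ A @ \oo --> nu_cls x.
Proof. by move=> <- /cls_densityP; apply: sim_cvg; exact: sim_repr. Qed.

Lemma cvg_cls A (l : R) : nu_ ^~ A @ \oo --> l ->
  cls_density (cls A : quot_null R) /\ nu_cls (cls A : quot_null R) = l.
Proof.
by move=> /has_density_cvg[dA <-]; split; [exists A|exact: nu_clsE].
Qed.

Lemma cls_density_compl x : cls_density x -> cls_density (~` x)%O.
Proof.
move=> /cls_densityP/density_setC/cvg_cls[+ _].
by rewrite -compl_cls [cls _]reprK.
Qed.

(** Disjointness of classes only gives a null intersection, which is all that
    the modular law needs. *)
Lemma cls_density_join x y : (x `&` y)%O = \bot%O ->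
  cls_density x -> cls_density y ->
  cls_density (x `|` y)%O /\ nu_cls (x `|` y)%O = nu_cls x + nu_cls y.
Proof.
elim/(@cls_ind R): x => A; elim/(@cls_ind R): y => B.
rewrite meet_cls bot_cls join_cls => /clsP AB dA dB.
apply: cvg_cls; apply: density_setU.
- by rewrite setY0 in AB.
- exact: cls_cvg dA.
- exact: cls_cvg dB.
Qed.

(** The order on classes is inclusion up to null sets; finite unions of
    representatives make it an honest inclusion without changing the classes. *)
Lemma cls_nested_lift p : nondecreasing_seq p ->
  exists2 U : nat -> set posint, {homo U : j k / (j <= k)%N >-> j `<=` k} &
    forall k, cls (U k) = p k.
Proof.
move=> incp.
pose U := fix U k := if k is j.+1 then U j `|` repr (p j.+1) else repr (p 0%N).
exists U.
  move=> j k; elim: k => [|k IH]; first by rewrite leqn0 => /eqP ->.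
  rewrite leq_eqVlt => /predU1P[->//|/IH jk].
  exact: subset_trans jk (@subsetUl _ _ _).
elim=> [|k IH]; first exact: reprK.
rewrite /= -join_cls IH [cls (repr _)]reprK; apply/join_r.
exact: incp.
Qed.

(** Completeness and continuity from below at once: the value of the supremum is
    part of the construction, and countable additivity needs it. *)
Lemma nu_cls_monotone_sup p : (forall k, cls_density (p k)) ->
  nondecreasing_seq p ->
  exists s, [/\ supremums (range p) s, cls_density s &
    nu_cls \o p @ \oo --> nu_cls s].
Proof.
move=> dp incp; have [U incU Up] := cls_nested_lift incp.
pose d := nu_cls \o p.
have Ud k : nu_ ^~ (U k) @ \oo --> d k by exact: cls_cvg (Up k) (dp k).
have incd : nondecreasing_seq d.
  move=> j k jk; rewrite -(cvg_lim _ (Ud j))// -(cvg_lim _ (Ud k))//.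
  apply: ler_lim; [exact: cvgP (Ud j)|exact: cvgP (Ud k)|].
  by near=> N; apply: le_nu; exact: incU.
have dcvg : cvgn d.
  apply: nondecreasing_is_cvgn => //; exists 1 => _ [k _ <-].
  rewrite -(cvg_lim _ (Ud k))//; apply: limr_le; first exact: cvgP (Ud k).
  by near=> N; exact: nu_le1.
have dL := nondecreasing_cvgn_le incd dcvg.
have [A AL UA] := nested_union_density incU Ud dL dcvg.
have [dA nuA] := cvg_cls AL.
exists (cls A); split=> //; last by rewrite nuA.
split=> [_ [k _ <-]|y]; first by rewrite -Up; apply/le_cls.
elim/(@cls_ind R): y => B ubB; apply/le_cls.
apply: (null_setD_of_density Ud dcvg AL UA) => k.
by apply/le_cls; rewrite Up; apply: ubB; exists k.
Unshelve. all: by end_near. Qed.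

Lemma cls_density_infimum p : (forall k, cls_density (p k)) ->
  nonincreasing_seq p -> exists2 s, cls_density s & infimums (range p) s.
Proof.
move=> dp decp.
have [||s [[ubs lubs] ds _]] := @nu_cls_monotone_sup (fun k => ~` p k)%O.
- by move=> k; exact: cls_density_compl.
- by move=> j k jk; rewrite leC; exact: decp.
exists (~` s)%O; first exact: cls_density_compl.
split=> [_ [k _ <-]|y lby]; first by rewrite leCx; apply: ubs; exists k.
rewrite lexC; apply: lubs => _ [k _ <-].
by rewrite leC; apply: lby; exists k.
Qed.

(** The strict bound k < n matches [series], whose n-th term sums over k < n. *)
Definition partial_join p n := (\join_(k < n) p k)%O.

Lemma partial_joinS p n : partial_join p n.+1 = (partial_join p n `|` p n)%O.
Proof. exact: big_ord_recr. Qed.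

Lemma supremums_partial_join p s :
  supremums (range (partial_join p)) s -> supremums (range p) s.
Proof.
move=> [ubs lubs]; split=> [_ [k _ <-]|y uby].
  apply: le_trans (ubs _ (ex_intro2 _ _ k.+1 I erefl)).
  by rewrite partial_joinS leUr.
apply: lubs => _ [n _ <-]; apply/joinsP => k _.
by apply: uby; exists (k : nat).
Qed.

Lemma nu_cls_partial_join p : (forall k, cls_density (p k)) ->
  (forall j k, j != k -> (p j `&` p k)%O = \bot%O) ->
  forall n, cls_density (partial_join p n) /\
    nu_cls (partial_join p n) = series (nu_cls \o p) n.
Proof.
move=> dp disj; elim=> [|n [dn nun]].
  rewrite /partial_join big_ord0 /series/= big_nil bot_cls.
  apply: cvg_cls; apply/nullP; exact: null_set0.
have disjn : (partial_join p n `&` p n)%O = \bot%O.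
  rewrite meetC; apply: joins_disjoint => k _.
  by apply: disj; rewrite neq_ltn ltn_ord orbT.
have [dS nuS] := cls_density_join disjn dn (dp n).
by rewrite partial_joinS nuS nun seriesSr.
Qed.

End Quotient.

Theorem corollary18 (R : realType) :
  is_monotone_class (@cls_density R) /\
  is_countably_additive (@cls_density R) (@nu_cls R).
Proof.
split; first split.
- by move=> p dp /(nu_cls_monotone_sup dp)[s [sup_s ds _]]; exists s.
- exact: cls_density_infimum.
move=> a da disj; have Ja := nu_cls_partial_join da disj.
have dJ n : cls_density (partial_join a n) by case: (Ja n).
have incJ : nondecreasing_seq (partial_join a).
  by apply/nondecreasing_seqP => n; rewrite partial_joinS leUl.
have [s [sup_s ds nus]] := nu_cls_monotone_sup dJ incJ.
exists s; split=> //; first exact: supremums_partial_join.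
suff -> : series (nu_cls \o a) = nu_cls \o partial_join a by [].
by apply/funext => n /=; case: (Ja n).
Qed.
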